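(* Let $G$ be a finite simple graph with maximum degree $\Delta(G)\geq 4$, and let $m,n$ be positive integers with $1<m<n$ and $m$ odd. Then $\chi(G^{\frac{m}{n}})\leq\omega(G^{\frac{m}{n}})+2$.
   Context: For a graph $G$ and positive integer $n$, the $n$-subdivision $G^{\frac{1}{n}}$ is obtained from $G$ by replacing each edge with a path of length $n$. For a graph $H$ and positive integer $m$, the $m$-th power $H^m$ is the graph on $V(H)$ in which two distinct vertices are adjacent iff their distance in $H$ is at most $m$. The fractional power is $G^{\frac{m}{n}}=(G^{\frac{1}{n}})^m$. $\chi$ denotes the chromatic number and $\omega$ the clique number. *)

(* Defs.v *)
From mathcomp Require Import all_boot.

Set Implicit Arguments.
Unset Strict Implicit.
Unset Printing Implicit Defensive.

Record sgraph := SGraph {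
  vertex :> finType;
  adj : rel vertex;
  adj_sym : symmetric adj;
  adj_irrefl : irreflexive adj }.

Definition max_degree (G : sgraph) : nat :=
  \max_(x : G) #|[set y | adj x y]|.

Definition clique (G : sgraph) (A : {set G}) : bool :=
  [forall x in A, forall y in A, (x != y) ==> adj x y].

Definition clique_number (G : sgraph) : nat :=
  \max_(A : {set G} | clique A) #|A|.

Definition proper_coloring (G : sgraph) (k : nat) (f : {ffun G -> 'I_k}) : bool :=
  [forall x, forall y, adj x y ==> (f x != f y)].

Definition colorable (G : sgraph) (k : nat) : bool :=
  [exists f : {ffun G -> 'I_k}, proper_coloring f].

Lemma colorable_ex (G : sgraph) : exists k, colorable G k.
Proof.
exists #|G|; apply/existsP; exists [ffun x => enum_rank x].
apply/forallP => x; apply/forallP => y; apply/implyP => xy; rewrite !ffunE.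
by apply: contraTneq xy => /enum_rank_inj ->; rewrite adj_irrefl.
Qed.

Definition chromatic_number (G : sgraph) : nat := ex_minn (colorable_ex G).

Definition walk (G : sgraph) (k : nat) (x y : G) : bool :=
  [exists p : k.-tuple G, path (@adj G) x p && (last x p == y)].

(* The least length of a walk from x to y.  Between vertices of the same
   component this is less than #|G|; for vertices in different components the
   value is #|G| and has no meaning, the distance being infinite. *)
Definition dist (G : sgraph) (x y : G) : nat :=
  find (fun k => walk k x y) (iota 0 #|G|).

Section Power.
Variables (G : sgraph) (m : nat).

Definition power_adj (x y : G) : bool :=
  [&& x != y, connect (@adj G) x y & dist x y <= m].

Lemma walk_sym k : symmetric (@walk G k).
Proof.
suff W (x y : G) : walk k x y -> walk k y x by move=> x y; apply/idP/idP; apply: W.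
case/existsP => p /andP[xp /eqP <-].
have sz : size (rev (belast x p)) == k by rewrite size_rev size_belast size_tuple.
apply/existsP; exists (Tuple sz) => /=.
rewrite rev_path (eq_path (e' := @adj G)) ?xp /=; last by move=> ? ?; apply: adj_sym.
by case: (tval p) => //= a s; rewrite rev_cons last_rcons.
Qed.

Lemma power_adj_sym : symmetric power_adj.
Proof.
move=> x y; rewrite /power_adj eq_sym.
rewrite (sym_connect_sym (@adj_sym G)); congr [&& _, _ & _ <= _].
by apply: eq_find => k; apply: walk_sym.
Qed.

Lemma power_adj_irrefl : irreflexive power_adj.
Proof. by move=> x; rewrite /power_adj eqxx. Qed.

Definition power : sgraph := SGraph power_adj_sym power_adj_irrefl.

End Power.

Section Subdivision.
Variables (G : sgraph) (n : nat).

(* Each edge of G is represented exactly once, by the orientation that agrees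
   with the enumeration of the vertices. *)
Definition edge : finType :=
  {p : G * G | adj p.1 p.2 && (enum_rank p.1 < enum_rank p.2)}.

Definition sub_vertex : finType := (G + edge * 'I_n.-1)%type.

(* For 0 <= k <= n, the k-th vertex of the path of length n that replaces a:
   one end of a for k = 0, the other end for k = n, and the new vertex
   (a, k - 1) for 0 < k < n. *)
Definition sub_path (a : edge) (k : nat) : sub_vertex :=
  if k is j.+1 then
    if insub j is Some i then inr (a, i) else inl (val a).2
  else inl (val a).1.

Definition sub_adj (u v : sub_vertex) : bool :=
  [exists a : edge, exists k : 'I_n,
    ((u == sub_path a k) && (v == sub_path a k.+1))
    || ((v == sub_path a k) && (u == sub_path a k.+1))].

Lemma sub_adj_sym : symmetric sub_adj.
Proof.
by move=> u v; apply: eq_existsb => a; apply: eq_existsb => k; rewrite orbC.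
Qed.

Lemma sub_path_neq a k : k < n -> sub_path a k != sub_path a k.+1.
Proof.
case: k => [|k] kn /=; case: insubP => [i lt_i vi|ge_k] //=.
  apply: contraTneq (valP a) => -[e12].
  by rewrite e12 ltnn andbF.
- case: insubP => [j _ vj|_] //; apply/eqP => -[ij].
  by move: vj; rewrite -ij vi => /n_Sn.
- by rewrite ltn_predRL kn in ge_k.
Qed.

Lemma sub_adj_irrefl : irreflexive sub_adj.
Proof.
move=> u; apply/existsP => - [a /existsP[k]].
by rewrite orbb => /andP[/eqP-> /idPn]; apply; apply: sub_path_neq.
Qed.

Definition subdivision : sgraph := SGraph sub_adj_sym sub_adj_irrefl.

End Subdivision.

Definition fractional_power (G : sgraph) (m n : nat) : sgraph :=
  power (subdivision G n) m.

(* Main.v *)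
(* Write m = 2k + 1 and D for the maximum degree.  The ball of radius k about a
   vertex of degree D, with one more vertex at distance k + 1, is a clique, so
   omega >= kD + 2.  Conversely kD + 3 colours suffice.  Choose h(u, v) < D for
   each half-edge so that h is injective around each u and h(u, v) != h(v, u)
   (Koenig's theorem for the bipartite graph G^(1/2)).  Give all the branch
   vertices one colour, and give the vertex at distance i <= k from u on the
   edge uv the colour (i, h(u, v)).  Points on different edges whose distance
   to the common end exceeds k are too far apart to conflict, so the middle of
   each edge is coloured on its own: two extra colours serve at distance k + 1
   from the ends, and the point at distance q > k + 1 from the nearer end reuses
   layer 2k + 2 - q with one of two values avoiding h(u, v) and h(v, u), which
   exist as D >= 4.  Edges of length at least 2(m + 1) are reduced modulo m + 1
   by repeating m + 1 consecutive colours. *)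
Require Import Defs.
From mathcomp Require Import all_boot zify.

Set Implicit Arguments.
Unset Strict Implicit.
Unset Printing Implicit Defensive.

(** * Colouring the half-edges of a graph of bounded degree *)

Section HalfEdges.
Variables (G : sgraph) (D : nat).
Hypothesis D_gt1 : 1 < D.
Hypothesis degD : forall x : G, #|[set y | adj x y]| <= D.

Definition half_edge_proper (h : {ffun G * G -> 'I_D}) : bool :=
  [forall x : G, forall y : G, forall z : G,
    [&& adj x y, adj x z & h (x, y) == h (x, z)] ==> (y == z)].

Definition conflicts (h : {ffun G * G -> 'I_D}) : {set G * G} :=
  [set d | adj d.1 d.2 && (h d == h (d.2, d.1))].

Lemma half_edge_properP (h : {ffun G * G -> 'I_D}) :
  reflect (forall x y z : G, adj x y -> adj x z -> h (x, y) = h (x, z) -> y = z)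
          (half_edge_proper h).
Proof.
apply: (iffP forallP) => [H x y z xy xz hxyz|H x].
  have /forallP/(_ y)/forallP/(_ z)/implyP := H x.
  by rewrite xy xz hxyz eqxx => /(_ isT)/eqP.
apply/forallP => y; apply/forallP => z; apply/implyP => /and3P[xy xz /eqP hxyz].
exact/eqP/(H x).
Qed.

Lemma half_edge_proper_ex : exists h, half_edge_proper h.
Proof.
have D_gt0 : 0 < D by apply: ltnW.
pose i0 := Ordinal D_gt0.
exists [ffun d => insubd i0 (index d.2 (enum [set y | adj d.1 y]))].
apply/half_edge_properP => x y z xy xz; rewrite !ffunE => /(congr1 val).
have idx (t : G) : adj x t -> index t (enum [set y | adj x y]) < D.
  by move=> xt; apply: leq_trans (degD x); rewrite cardE index_mem mem_enum inE.
rewrite !val_insubd /= !idx // => e.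
have := congr1 (nth x (enum [set y | adj x y])) e.
by rewrite !nth_index ?mem_enum ?inE.
Qed.

(* Kempe change: exchange al and be at all vertices reached from v along edges
   which are coloured be at their tail and al at their head.  A vertex has at
   most one predecessor, so no edge leaving this set acquires a conflict, and u
   stays outside because its only al-edge leads to v. *)
Lemma kempe_change (h : {ffun G * G -> 'I_D}) u v :
  half_edge_proper h -> (u, v) \in conflicts h ->
  exists2 h', half_edge_proper h' & #|conflicts h'| < #|conflicts h|.
Proof.
move=> /half_edge_properP hP; rewrite inE /= => /andP[uv /eqP huv].
pose al := h (u, v).
have [be be_al] : exists be, be != al.
  have D_gt0 : 0 < D by apply: ltnW.
  case: (eqVneq al (Ordinal D_gt0)) => [->|]; first by exists (Ordinal D_gt1).
  by rewrite eq_sym; exists (Ordinal D_gt0).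
pose R : rel G := fun x y => [&& adj x y, h (x, y) == be & h (y, x) == al].
pose X := [set x | connect R v x].
pose s (c : 'I_D) := if c == al then be else if c == be then al else c.
have sK : involutive s.
  move=> c; rewrite /s; case: (eqVneq c al) => [->|c_al].
    by rewrite eqxx (negPf be_al).
  case: (eqVneq c be) => [->|c_be]; first by rewrite eqxx.
  by rewrite (negPf c_al) (negPf c_be).
pose h' := [ffun d => if d.1 \in X then s (h d) else h d].
have R_into y : R y v -> False.
  case/and3P=> yv /eqP hyv /eqP hvy.
  have e : y = u by apply: (hP v); rewrite // 1?adj_sym // hvy.
  by case/eqP: be_al; rewrite -hyv e.
have Rback x y : x \in X -> R y x -> y \in X.
  rewrite !inE => /connectP[p]; elim/last_ind: p => [_ -> /R_into //|p z _].
  rewrite rcons_path last_rcons => /andP[vp Rz] -> Ryz.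
  suff -> : y = last v p by apply/connectP; exists p.
  case/and3P: Rz => az _ /eqP hz; case/and3P: Ryz => ay _ /eqP hy.
  by apply: (hP z); rewrite 1?adj_sym // hz hy.
have Rfwd x y : x \in X -> R x y -> y \in X.
  by rewrite !inE => vx /connect1; apply: connect_trans.
have vX : v \in X by rewrite inE connect0.
have uX : u \notin X.
  rewrite inE; apply/negP => /connectP[p]; elim/last_ind: p => [_ /= e|p z _].
    by rewrite e adj_irrefl in uv.
  rewrite rcons_path last_rcons => /andP[_ /and3P[az /eqP hz /eqP hz']] e.
  have e' : last v p = v by apply: (hP u); rewrite // e 1?adj_sym // hz' -e.
  by case/eqP: be_al; rewrite -hz e' -e -huv.
(* An edge leaving [X] could gain a conflict only if its two half-edges carry [al] and [be]; it
   would then be an arc of [R] in one direction, and [X] is closed under both. *)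
have out x y : x \in X -> y \notin X -> adj x y ->
    s (h (x, y)) = h (y, x) -> h (x, y) = h (y, x).
  move=> xX yX xy; rewrite /s; case: eqVneq => [hx hy|_].
    by case/negP: yX; apply: Rback xX _; rewrite /R adj_sym xy -hy hx !eqxx.
  case: eqVneq => // hx hy.
  by case/negP: yX; apply: Rfwd xX _; rewrite /R xy -hy hx !eqxx.
exists h'.
  apply/half_edge_properP => x y z xy xz; rewrite !ffunE /=.
  case: ifP => _; last exact: hP.
  by move=> /(inv_inj sK); apply: hP.
apply: proper_card; apply/properP; split.
  apply/subsetP => -[x y]; rewrite !inE /= !ffunE /= => /andP[xy /eqP hxy].
  rewrite xy /=; apply/eqP; move: hxy.
  case: ifPn => xX; case: ifPn => yX //.
  - exact: inv_inj sK _ _.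
  - exact: out.
  - by move=> e; apply/esym/out; rewrite // adj_sym.
exists (u, v); rewrite inE /= ?uv ?huv //= !ffunE /= (negPf uX) vX.
by rewrite -huv -/al /s eqxx eq_sym.
Qed.

(** A proper [h] with the fewest conflicts has none, since a Kempe change would remove one. *)
Lemma half_edge_coloring_ex :
  exists h : G -> G -> nat,
    [/\ forall x y, h x y < D,
        forall x y z, adj x y -> adj x z -> h x y = h x z -> y = z
      & forall x y, adj x y -> h x y != h y x].
Proof.
have [h0 h0P] := half_edge_proper_ex.
case: (arg_minnP (fun h => #|conflicts h|) h0P) => h hP hmin.
exists (fun x y => nat_of_ord (h (x, y) : 'I_D)).
split=> [x y|x y z xy xz /val_inj|x y xy].
- exact: ltn_ord.
- by move/half_edge_properP: hP; apply.
apply/eqP => /val_inj hxy.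
have [|h' /hmin] := @kempe_change h x y hP; first by rewrite inE /= xy hxy eqxx.
by rewrite leqNgt => /negPf->.
Qed.
End HalfEdges.

(** * Colouring a single subdivided edge *)

Section PathColoring.
Variables (k n a b : nat).
Hypotheses (k_gt0 : 0 < k) (n_ge : k.*2.+2 <= n) (ab : a != b).

(** At least two of the values 0, ..., 3 survive the removal of [a] and [b], so the default of [nth]
    is never reached for [i < 2]. These values are legal because D >= 4. *)
Definition spare_color (i : nat) : nat :=
  nth 0 [seq c <- iota 0 4 | c \notin [:: a; b]] i.

Lemma spare_colorP :
  [/\ spare_color 0 < 4, spare_color 1 < 4
    & uniq [:: a; b; spare_color 0; spare_color 1]].
Proof.
move: ab; rewrite /spare_color.
case: a b => [|[|[|[|?]]]] [|[|[|[|?]]]] //=;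
  rewrite ?inE ?andbT ?eqxx; try lia.
by move=> /negPf->.
Qed.

(* The residue of n modulo m + 1 = k.*2.+2 in the range m + 1, ..., 2m + 1. *)
Definition core_length : nat := k.*2.+2 + n %% k.*2.+2.

(* The colour at distance q from the nearer end, as a pair (layer, value). *)
Definition half_color (c x i q : nat) : nat * nat :=
  if q == 0 then (0, 0)
  else if q <= k then (q, c)
  else if q == k.+1 then (q, i)
  else (k.*2.+2 - q, x).

Definition core_color (p : nat) : nat * nat :=
  if p.*2 <= core_length then half_color a (spare_color 0) 0 p
  else half_color b (spare_color 1) 1 (core_length - p).

(** Positions below [s], a multiple of m + 1, run periodically through the first m + 1 colours of
    the core, which then follows once in full. *)
Definition path_color (p : nat) : nat * nat :=
  let s := n - core_length in
  core_color (if p < s then p %% k.*2.+2 else p - s).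

Lemma core_length_bounds : k.*2.+2 <= core_length < (k.*2.+2).*2.
Proof. by have := @ltn_pmod n k.*2.+2 isT; rewrite /core_length; lia. Qed.

(** Within one half a layer repeats only with a different value; across the halves, [a], [b] and the
    two spare values are pairwise distinct, and layer k + 1 holds 0 on one side and 1 on the
    other. *)
Lemma core_color_inj p p' :
  p < p' <= core_length -> core_color p = core_color p' ->
  p = 0 /\ p' = core_length.
Proof.
have := core_length_bounds; have [_ _] := spare_colorP.
rewrite /core_color /half_color /= !inE !negb_or.
move: core_length (spare_color 0) (spare_color 1) => N x y U NB pp'.
by do !case: ifP => ?; move=> e; move: (congr1 fst e) (congr1 snd e) => /=; lia.
Qed.

Lemma core_length_split : exists2 q, n - core_length = q * k.*2.+2
  & n = q * k.*2.+2 + core_length.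
Proof.
(* The quotient drops by one because [core_length] contains one full period. *)
exists (n %/ k.*2.+2).-1; rewrite /core_length;
  have := divn_eq n k.*2.+2; have : 0 < n %/ k.*2.+2 by rewrite divn_gt0.
all: by case: (n %/ _) => // j _; rewrite mulSn /=; move: (j * _); lia.
Qed.

Lemma path_color_inj p p' :
  p < p' <= n -> p' < p + k.*2.+2 -> path_color p != path_color p'.
Proof.
move=> /andP[pp' p'n] p'p; apply/eqP; rewrite /path_color.
have [q -> nq] := core_length_split.
have /andP[NM _] := core_length_bounds.
have resM r : r %% k.*2.+2 < k.*2.+2 by rewrite ltn_pmod.
case: ltnP => [ps|ps]; case: ltnP => [p's|p's].
- have neq : p %% k.*2.+2 != p' %% k.*2.+2.
    rewrite eq_sym eqn_mod_dvd ?(ltnW pp') //.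
    by apply/negP => /dvdn_leq; rewrite subn_gt0; lia.
  have := resM p; have := resM p' => r r'.
  case: (ltngtP (p %% k.*2.+2) (p' %% k.*2.+2)) neq => // lt_res _.
    by move=> /core_color_inj []; lia.
  by move=> /esym/core_color_inj []; lia.
(* The period containing [p] ends at or before the start of the core, so p' < p + m + 1 puts the
   core position of [p'] strictly below the residue of [p]. *)
- have pq : p %/ k.*2.+2 < q by rewrite ltn_divLR.
  have := leq_mul pq (leqnn k.*2.+2); rewrite mulSn.
  have := divn_eq p k.*2.+2; have := resM p; move: (_ %/ _ * _) => t.
  by move=> rM ep tq /esym/core_color_inj []; lia.
- by lia.
- by move=> /core_color_inj []; lia.
Qed.

Lemma path_color0 : path_color 0 = (0, 0).
Proof.
rewrite /path_color sub0n mod0n if_same /core_color double0 leq0n.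
by rewrite /half_color eqxx.
Qed.

Lemma path_colorn : path_color n = (0, 0).
Proof.
have [q _ nq] := core_length_split; have NB := core_length_bounds.
rewrite /path_color ltnNge leq_subr /= subKn; last by rewrite nq leq_addl.
have /negbTE N2 : ~~ (core_length.*2 <= core_length) by lia.
by rewrite /core_color N2 subnn.
Qed.

Lemma path_color_left p : p < k.*2.+2 -> path_color p = core_color p.
Proof.
have [q e nq] := core_length_split; rewrite /path_color e => pM.
by case: q {nq e} => [|q]; rewrite ?subn0 // mulSn ltn_addr // modn_small.
Qed.

Lemma path_color_right p :
  p < k.*2.+2 -> path_color (n - p) = core_color (core_length - p).
Proof.
have [q e nq] := core_length_split; have := core_length_bounds.
rewrite /path_color => NB pM; case: ltnP => ?; first lia.
by congr core_color; lia.
Qed.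

Lemma path_color_left_small p : 0 < p <= k -> path_color p = (p, a).
Proof.
move=> pk; rewrite path_color_left; last lia.
have := core_length_bounds; rewrite /core_color /half_color => NB.
by do !case: ifP => //; lia.
Qed.

Lemma path_color_right_small p : 0 < p <= k -> path_color (n - p) = (p, b).
Proof.
move=> pk; rewrite path_color_right; last lia.
have := core_length_bounds; rewrite /core_color /half_color => NB.
have -> : core_length - (core_length - p) = p by lia.
by do !case: ifP => //; lia.
Qed.

(** Serves where two subdivided edges share an end: a point of the other edge at distance j <= m - p
    from it lies in layer j, which is too low to conflict. *)
Lemma path_color_left_large p :
  k < p < k.*2.+2 -> k.*2.+2 - p <= (path_color p).1.
Proof.
move=> pk; rewrite path_color_left; last lia.
have := core_length_bounds; rewrite /core_color /half_color => NB.
by do !case: ifP => /=; lia.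
Qed.

Lemma path_color_right_large p :
  k < p < k.*2.+2 -> k.*2.+2 - p <= (path_color (n - p)).1.
Proof.
move=> pk; rewrite path_color_right; last lia.
have := core_length_bounds; rewrite /core_color /half_color => NB.
by do !case: ifP => /=; lia.
Qed.

(** This limits the palette to one colour in layer 0, D in each of the layers 1, ..., k and two in
    layer k + 1, that is kD + 3. *)
Lemma path_color_bounds D p : 4 <= D -> a < D -> b < D -> p <= n ->
  let c := path_color p in
  [/\ c.2 < D, c.1 = 0 -> c.2 = 0 & c.1 <= k \/ c.1 = k.+1 /\ c.2 < 2].
Proof.
move=> D4 aD bD pn; have [x4 y4 _] := spare_colorP.
have NB := core_length_bounds; rewrite /path_color.
set i := if _ then _ else _; have : i <= core_length.
  by rewrite /i; case: ifP => _; [have := @ltn_pmod p k.*2.+2 isT|]; lia.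
move: i => i; rewrite /core_color /half_color.
by do !case: ifP => /=; move=> *; split; lia.
Qed.

End PathColoring.

(** * Adjacency in a power, expressed by walks *)

Section Walks.
Variable G : sgraph.
Implicit Types x y z : G.

Lemma walkP k x y :
  reflect (exists2 p, size p = k & path (@adj G) x p /\ last x p = y)
          (walk k x y).
Proof.
apply: (iffP existsP) => [[p /andP[xp /eqP py]]|[p pk [xp <-]]].
  by exists p; rewrite ?size_tuple.
by exists (tcast pk (in_tuple p)); rewrite val_tcast xp eqxx.
Qed.

Lemma walk_cat k l x y z : walk k x y -> walk l y z -> walk (k + l) x z.
Proof.
move=> /walkP[p <- [xp <-]] /walkP[q <- [pq <-]]; apply/walkP.
by exists (p ++ q); rewrite ?size_cat // cat_path last_cat xp.
Qed.

Lemma power_adjP m x y :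
  reflect (x != y /\ exists2 k, k <= m & walk k x y) (power_adj m x y).
Proof.
apply: (iffP and3P) => [[xy cxy dm]|[xy [k km kxy]]].
  split=> //; exists (dist x y) => //; case/connectP: cxy => p0 xp0.
  (* A walk without repeated vertices is shorter than [#|G|], so the search in [dist] succeeds
     before running off its range. *)
  case: (shortenP xp0) => p xp up _ yp.
  have lt_p : size p < #|G| by have := card_uniqP up => /= <-; exact: max_card.
  have has_w : has (fun k => walk k x y) (iota 0 #|G|).
    by apply/hasP; exists (size p); rewrite ?mem_iota //; apply/walkP; exists p.
  have := nth_find 0 has_w; rewrite nth_iota ?add0n //.
  by rewrite has_find size_iota in has_w.
split=> //.
  by case/walkP: kxy => p _ [xp <-]; apply/connectP; exists p.
apply: leq_trans km; rewrite /dist leqNgt; apply/negP => lt_k.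
have lt_kG : k < #|G|.
  by apply: leq_trans lt_k _; rewrite -[leqRHS](size_iota 0) find_size.
by have := before_find 0 lt_k; rewrite nth_iota // add0n kxy.
Qed.

End Walks.

(** * Points of the subdivision and short walks between them *)

Section Darts.
Variables (G : sgraph) (n : nat).
Hypothesis n_gt1 : 1 < n.
Implicit Types u v w : G.

(** [edge] stores only one orientation; this reads the same path from either end, with positions
    counted from [u]. The last branch is reached only when [u] and [v] are not adjacent. *)
Definition dart_path u v (p : nat) : sub_vertex G n :=
  if insub (u, v) is Some a then Defs.sub_path n a p
  else if insub (v, u) is Some a then Defs.sub_path n a (n - p)
  else inl u.

Lemma sub_pathn (a : edge G) :
  Defs.sub_path n a n = inl (val a).2 :> sub_vertex G n.
Proof.
by case: n n_gt1 => //= j _; case: insubP => // i; rewrite ltnn.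
Qed.

Lemma dart_pathE u v : adj u v ->
  (exists2 a : edge G, val a = (u, v) & dart_path u v =1 Defs.sub_path n a) \/
  (exists2 a : edge G, val a = (v, u)
     & forall p, dart_path u v p = Defs.sub_path n a (n - p)).
Proof.
move=> uv; rewrite /dart_path; case: insubP => [a _ va|].
  by left; exists a.
rewrite uv -leqNgt leq_eqVlt => /predU1P[|lt_vu].
  by move=> /val_inj/enum_rank_inj/= vu; rewrite vu adj_irrefl in uv.
right; case: insubP => [a _ va|]; first by exists a.
by rewrite adj_sym uv lt_vu.
Qed.

Lemma dart_path_sym u v p : adj u v -> p <= n ->
  dart_path u v p = dart_path v u (n - p).
Proof.
move=> uv pn.
case: (dart_pathE uv) => -[a va ->];
  (case: (@dart_pathE v u); first by rewrite adj_sym);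
  move=> -[b vb ->]; rewrite ?subKn //.
- have := valP a; have := valP b; rewrite va vb /=.
  by move=> /andP[_ ?] /andP[_ ?]; lia.
- by have -> : a = b by apply: val_inj; rewrite va vb.
- by have -> : a = b by apply: val_inj; rewrite va vb.
- have := valP a; have := valP b; rewrite va vb /=.
  by move=> /andP[_ ?] /andP[_ ?]; lia.
Qed.

Lemma dart_path0 u v : adj u v -> dart_path u v 0 = inl u.
Proof.
case/dart_pathE => -[a va ->] /=; rewrite ?va // subn0 sub_pathn va //.
Qed.

Lemma sub_path_inj (a b : edge G) p q : 0 < p < n -> q <= n ->
  Defs.sub_path n a p = Defs.sub_path n b q :> sub_vertex G n -> a = b /\ p = q.
Proof.
case: p => // p /= pn; case: q => [|q] qn /=;
  case: insubP => [i _ vi|]; try lia.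
  by [].
by case: insubP => [j _ vj|] // [-> ij]; rewrite -vi ij vj.
Qed.

Lemma dart_path_inner_inj u v w x p q : adj u v -> adj w x ->
  0 < p < n -> q <= n -> dart_path u v p = dart_path w x q ->
  [\/ [/\ u = w, v = x & p = q] | [/\ u = x, v = w & p = n - q]].
Proof.
move=> uv wx pn qn.
case: (dart_pathE uv) => -[a va ->]; case: (dart_pathE wx) => -[b vb ->];
  case/sub_path_inj; try lia; move=> ab pq;
  rewrite ab vb in va; case: va => -> ->;
  first [by left; split=> //; lia | by right; split=> //; lia].
Qed.

Lemma dart_path_end u v w p : adj u v -> p <= n -> dart_path u v p = inl w ->
  p = 0 /\ w = u \/ p = n /\ w = v.
Proof.
move=> uv pn; case: (posnP p) => [->|p0].
  by rewrite dart_path0 // => -[->]; left.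
case: (ltngtP p n) pn => // [pn|->] _; last first.
  by rewrite dart_path_sym // subnn dart_path0 1?adj_sym // => -[->]; right.
have inner (a : edge G) q :
    0 < q < n -> Defs.sub_path n a q = inl w :> sub_vertex G n -> False.
  by case: q => // q /= qn; case: insubP => //; lia.
by case: (dart_pathE uv) => -[a _ ->] /inner []; lia.
Qed.

(** Reversing the dart where necessary turns every adjacency into a forward step. *)
Lemma sub_adjP (x y : subdivision G n) :
  adj x y -> exists u v k,
   [/\ adj u v, k < n, x = dart_path u v k & y = dart_path u v k.+1].
Proof.
case/existsP => a /existsP[k].
have /andP[uv lt_uv] := valP a.
have [e|[b vb]] := dart_pathE uv; last first.
  have := valP b; rewrite vb /= => /andP[_ lt_vu].
  by have := ltn_trans lt_uv lt_vu; rewrite ltnn.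
have {}e : dart_path (val a).1 (val a).2 =1 Defs.sub_path n a.
  case: e => b vb; suff -> : b = a by [].
  by apply: val_inj; rewrite vb; case: (val a).
case/orP => /andP[/eqP-> /eqP->].
  by exists (val a).1, (val a).2, k; rewrite !e.
have := ltn_ord k => kn.
exists (val a).2, (val a).1, (n - k.+1); split; rewrite 1?adj_sym //; try lia.
  by rewrite dart_path_sym ?e ?leq_subr 1?adj_sym // subKn.
rewrite dart_path_sym ?e 1?adj_sym //; last lia.
by have -> : n - (n - k.+1).+1 = k by lia.
Qed.

Lemma dart_path_adj u v k : adj u v -> k < n ->
  @adj (subdivision G n) (dart_path u v k) (dart_path u v k.+1).
Proof.
move=> uv kn; have [[a _ e]|[a _ e]] := dart_pathE uv; rewrite !e;
  apply/existsP; exists a.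
  by apply/existsP; exists (Ordinal kn); rewrite !eqxx.
have kn' : n - k.+1 < n by lia.
apply/existsP; exists (Ordinal kn').
by have -> : n - k = (Ordinal kn').+1 by [rewrite /=; lia]; rewrite !eqxx orbT.
Qed.

(* The positions j and p are both counted from u; for v = w the two points lie
   on the same subdivided edge, otherwise the walk joining them passes u. *)
Definition near (l : nat) (x y : subdivision G n) : Prop :=
  exists u v w j p,
    [/\ adj u v, adj u w, x = dart_path u v j & y = dart_path u w p] /\
    if v == w then [/\ j <= n, p <= n, j <= p + l & p <= j + l] else j + p <= l.

(** As l < n, a fork never reaches a far end, so a single common branch vertex always suffices to
    locate both points. *)
Lemma near_adj l x y z : l < n -> near l x y -> adj y z -> near l.+1 x z.
Proof.
move=> ln [u [v [w [j [p [[uv uw -> y_uw] jp]]]]]].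
case/sub_adjP=> a [b [k [ab kn y_ab ->]]].
have pn : p <= n by case: eqP jp => _ => [[]|]; lia.
have {}y_ab : dart_path u w p = dart_path a b k by rewrite -y_uw.
have [p_end|p_in] : p = 0 \/ p = n \/ 0 < p < n by lia.
- rewrite p_end dart_path0 // in y_ab.
  have [[k0 ua]|[]] := dart_path_end ab (ltnW kn) (esym y_ab); last lia.
  subst a k p; exists u, v, b, j, 1; split=> //.
  have [] : j <= n /\ j <= l by case: eqP jp => _ => [[]|]; lia.
  by case: eqP => _ ? ?; [split|]; lia.
case: p_in => [p_end|p_in].
(* Here [y] is the far end [w], which forces v = w; the description is recentred at [w], where [x]
   has position n - j. *)
- rewrite p_end dart_path_sym // subnn dart_path0 1?adj_sym // in y_ab.
  have [[k0 wa]|[]] := dart_path_end ab (ltnW kn) (esym y_ab); last lia.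
  subst a k p; case: eqP jp => [vw|]; last lia.
  case=> jn _ _ nj; subst w; exists v, u, b, (n - j), 1; split.
    by split; rewrite // 1?adj_sym // dart_path_sym.
  by case: eqP => _; [split|]; lia.
case: (dart_path_inner_inj uw ab p_in (ltnW kn) y_ab) => [][? ? pk]; subst a b.
  exists u, v, w, j, k.+1; split=> //.
  by move: jp; case: eqP => _ => [[]|]; [split|]; lia.
exists u, v, w, j, (p.-1); split.
  split=> //; rewrite dart_path_sym // 1?adj_sym //; congr dart_path; lia.
by move: jp; case: eqP => _ => [[]|]; [split|]; lia.
Qed.

Lemma walk_near l x y : l < n -> walk l x y -> x = y \/ near l x y.
Proof.
elim: l y => [|l IHl] y ln /walkP[p].
  by move/size0nil=> -> [_ /= ->]; left.
case/lastP: p => // p z; rewrite size_rcons rcons_path last_rcons.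
move=> -[pl] [/andP[xp pz] <-].
right; have : walk l x (last x p) by apply/walkP; exists p.
case/(IHl _ (ltnW ln)) => [e|nr]; last exact: near_adj (ltnW ln) nr pz.
move: pz; rewrite -e => /sub_adjP[u [v [k [uv kn -> ->]]]].
exists u, v, v, k, k.+1; split=> //; rewrite eqxx; split; lia.
Qed.

Lemma dart_path_walk u v p : adj u v -> p <= n ->
  @walk (subdivision G n) p (inl u) (dart_path u v p).
Proof.
move=> uv; elim: p => [_|p IHp pn].
  by rewrite dart_path0 //; apply/walkP; exists [::].
rewrite -addn1; apply: (walk_cat (IHp (ltnW pn))); apply/walkP.
exists [:: dart_path u v p.+1] => //; split; last by rewrite addn1.
by rewrite /= andbT; exact: dart_path_adj.
Qed.

End Darts.

(** * A large clique around a vertex *)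

Section Clique.
Variables (G : sgraph) (k n : nat).
Hypotheses (k_gt0 : 0 < k) (n_ge : k.*2.+2 <= n).

Lemma dart_path_power_adj (u v w : G) j p :
  adj u v -> adj u w -> j <= n -> p <= n -> j + p <= k.*2.+1 ->
  dart_path n u v j != dart_path n u w p ->
  @adj (fractional_power G k.*2.+1 n) (dart_path n u v j) (dart_path n u w p).
Proof.
move=> uv uw jn pn jp neq; apply/power_adjP; split=> //; exists (j + p) => //.
have n_gt1 : 1 < n by lia.
apply: walk_cat (dart_path_walk n_gt1 uw pn).
by rewrite walk_sym dart_path_walk.
Qed.

Lemma clique_number_ge (u : G) :
  0 < #|[set v | adj u v]| ->
  k * #|[set v | adj u v]| + 2 <= clique_number (fractional_power G k.*2.+1 n).
Proof.
case/card_gt0P => v0; rewrite inE => uv0.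
pose N := {v : G | adj u v}.
have n_gt1 : 1 < n by lia.
(* [Some (Some (i, v))] indexes the point at position i + 1 towards [v], [Some None] the vertex [u],
   and [None] the extra point at position k + 1 towards [v0]. *)
pose dart (t : option (option ('I_k * N))) : G :=
  if t is Some (Some (_, v)) then val v else v0.
pose pos (t : option (option ('I_k * N))) : nat :=
  match t with None => k.+1 | Some None => 0 | Some (Some (i, _)) => i.+1 end.
have dartP t : adj u (dart t) by case: t => [[[i v]|]|] //=; apply: (valP v).
have pos_le t : pos t <= k.+1.
  by case: t => [[[i v]|]|] //=; rewrite ltnS ltnW.
have pos_max t : pos t = k.+1 -> t = None.
  by case: t => [[[i v]|]|] //= [ik]; have := ltn_ord i; rewrite ik ltnn.
pose F t : fractional_power G k.*2.+1 n := dart_path n u (dart t) (pos t).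
have F_inj : injective F.
  move=> t t'; rewrite /F => e; wlog pos0 : t t' e / 0 < pos t.
    move=> W; case: (posnP (pos t)) => [p0|]; last exact: W.
    case: (posnP (pos t')) => [p0'|p0']; last by apply/esym/W.
    by move: p0 p0'; case: t t' {e W} => [[[i v]|]|] [[[i' v']|]|].
  have pn : 0 < pos t < n by have := pos_le t; lia.
  have pn' : pos t' <= n by have := pos_le t'; lia.
  have := dart_path_inner_inj n_gt1 (dartP t) (dartP t') pn pn' e.
  have lt_t := pos_le t; have lt_t' := pos_le t'.
  case=> [][eu ev ep].
    case: t t' ev ep {e pos0 pn pn' lt_t lt_t'}
      => [[[i v]|]|] [[[i' v']|]|] //=.
    - by move=> /val_inj -> [/val_inj ->].
    - by move=> _ []; have := ltn_ord i; lia.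
    - by move=> _ []; have := ltn_ord i'; lia.
  (* Positions counted from opposite ends add up to n >= 2k + 2, so both are k + 1. *)
  have [pt pt'] : pos t = k.+1 /\ pos t' = k.+1 by lia.
  by rewrite (pos_max t pt) (pos_max t' pt').
have -> : k * #|[set v | adj u v]| + 2 = #|F @: setT|.
  rewrite card_imset // cardsT !card_option card_prod card_ord card_sig addn2.
  by congr (k * _).+2; apply: eq_card => v; rewrite !inE.
apply: (leq_bigmax_cond
  (F := fun A : {set fractional_power G k.*2.+1 n} => #|A|)).
apply/forallP => x; apply/implyP => /imsetP[t _ ->].
apply/forallP => y; apply/implyP => /imsetP[t' _ ->]; apply/implyP => tt'.
have lt_t := pos_le t; have lt_t' := pos_le t'.
apply: dart_path_power_adj => //; try lia.
(* The positions add up to more than 2k + 1 only if both are k + 1, and only [None] has that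
   position. *)
have [eq_t|neq_t] := eqVneq (pos t) k.+1;
  have [eq_t'|neq_t'] := eqVneq (pos t') k.+1; try lia.
by case/eqP: tt'; rewrite (pos_max t eq_t) (pos_max t' eq_t').
Qed.

End Clique.

(** * The proper colouring with kD + 3 colours *)

Section Coloring.
Variables (G : sgraph) (k n D : nat).
Hypotheses (k_gt0 : 0 < k) (n_ge : k.*2.+2 <= n) (D_ge4 : 4 <= D).
Variable h : G -> G -> nat.
Hypotheses (h_lt : forall u v, h u v < D)
  (h_inj : forall u v w, adj u v -> adj u w -> h u v = h u w -> v = w)
  (h_sym : forall u v, adj u v -> h u v != h v u).

Definition vertex_color (x : sub_vertex G n) : nat * nat :=
  if x is inr (a, i) then
    path_color k n (h (val a).1 (val a).2) (h (val a).2 (val a).1) i.+1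
  else (0, 0).

Lemma vertex_color_sub_path (a : edge G) p : p <= n ->
  vertex_color (Defs.sub_path n a p) =
  path_color k n (h (val a).1 (val a).2) (h (val a).2 (val a).1) p.
Proof.
move=> pn; have n_gt1 : 1 < n by lia.
case: p pn => [|p] pn; first by rewrite path_color0.
move: pn; rewrite leq_eqVlt => /predU1P[->|pn].
  by rewrite sub_pathn // path_colorn // h_sym //; case/andP: (valP a).
by rewrite /=; case: insubP => [i _ <-|] //=; lia.
Qed.

Lemma vertex_color_neq u v j p : adj u v -> j < p <= n -> p < j + k.*2.+2 ->
  vertex_color (dart_path n u v j) != vertex_color (dart_path n u v p).
Proof.
move=> uv jp pj; case: (dart_pathE n uv) => -[a va e];
  rewrite !e !vertex_color_sub_path ?va /=; try lia.
  by apply: path_color_inj => //; exact: h_sym.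
by rewrite eq_sym; apply: path_color_inj; rewrite ?h_sym 1?adj_sym //; lia.
Qed.

Lemma vertex_color_small u v p : adj u v -> 0 < p <= k ->
  vertex_color (dart_path n u v p) = (p, h u v).
Proof.
move=> uv pk; case: (dart_pathE n uv) => -[a va e];
  rewrite !e !vertex_color_sub_path ?va /=; try lia.
  by rewrite path_color_left_small // h_sym.
by rewrite path_color_right_small // h_sym // adj_sym.
Qed.

Lemma vertex_color_large u v p : adj u v -> k < p < k.*2.+2 ->
  k.*2.+2 - p <= (vertex_color (dart_path n u v p)).1.
Proof.
move=> uv pk; case: (dart_pathE n uv) => -[a va e];
  rewrite !e !vertex_color_sub_path ?va /=; try lia.
  by rewrite path_color_left_large // h_sym.
by rewrite path_color_right_large // h_sym // adj_sym.
Qed.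

(** The nearer point has j <= k, hence colour [(j, h u v)]. If p <= k, injectivity of [h] around [u]
    separates the colours; otherwise the other layer is at least 2k + 2 - p > j. *)
Lemma vertex_color_fork u v w j p : adj u v -> adj u w -> v != w ->
  0 < j -> 0 < p -> j <= p -> j + p <= k.*2.+1 ->
  vertex_color (dart_path n u v j) != vertex_color (dart_path n u w p).
Proof.
move=> uv uw vw j0 p0 le_jp jp; rewrite vertex_color_small //; last lia.
case: (leqP p k) => pk.
  rewrite vertex_color_small ?p0 //; apply: contraNneq vw => -[_ hvw].
  by apply/eqP/(h_inj uv uw).
have : k.*2.+2 - p <= (vertex_color (dart_path n u w p)).1.
  by apply: vertex_color_large => //; lia.
by apply: contraTneq => <- /=; lia.
Qed.

Lemma vertex_color_proper (x y : fractional_power G k.*2.+1 n) :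
  adj x y -> vertex_color x != vertex_color y.
Proof.
have n_gt1 : 1 < n by lia.
move=> /power_adjP[xy [l lm lxy]].
have ln : l < n by lia.
case: (walk_near n_gt1 ln lxy) xy => [->|]; first by rewrite eqxx.
case=> u [v [w [j [p [[uv uw -> ->] jp]]]]] xy.
have same i q z : adj u z -> i <= n -> q <= n -> i <= q + l -> q <= i + l ->
    dart_path n u z i != dart_path n u z q ->
    vertex_color (dart_path n u z i) != vertex_color (dart_path n u z q).
  move=> uz i_n qn iq qi.
  case: (ltngtP i q) => [lt_iq|lt_qi|->]; last by rewrite eqxx.
    by move=> _; apply: vertex_color_neq => //; lia.
  by move=> _; rewrite eq_sym; apply: vertex_color_neq => //; lia.
case: eqVneq jp xy => [<- []|vw jp]; first by move=> *; apply: same.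
have end0 z : adj u z -> dart_path n u z 0 = inl u by exact: dart_path0.
(* If one point is [u] itself, it is position 0 on the dart of the other, and the case of a common
   edge applies. *)
case: (posnP j) => [j0|j0].
  by rewrite j0 end0 // -(end0 w) // => ?; apply: same => //; lia.
case: (posnP p) => [p0|p0].
  rewrite p0 [dart_path n u w 0]end0 // -(end0 v) // => ?.
  by apply: same => //; lia.
move=> _; case: (leqP j p) => [le_jp|/ltnW le_pj].
  by apply: vertex_color_fork => //; lia.
by rewrite eq_sym; apply: vertex_color_fork; rewrite // 1?eq_sym //; lia.
Qed.

(** Consecutive numbering of the palette in blocks of D; the two colours of layer k + 1 become kD +
    1 and kD + 2. *)
Definition color_code (c : nat * nat) : nat :=
  if c.1 is i.+1 then (i * D + c.2).+1 else 0.

Lemma vertex_color_bounds x : let c := vertex_color x in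
  [/\ c.2 < D, c.1 = 0 -> c.2 = 0 & c.1 <= k \/ c.1 = k.+1 /\ c.2 < 2].
Proof.
case: x => [u|[a i]] /=; first by split=> //; [lia | left].
have /andP[uv _] := valP a.
have lt_i : i.+1 <= n by have := ltn_ord i; lia.
exact: (path_color_bounds k_gt0 n_ge (h_sym uv) D_ge4
  (h_lt _ _) (h_lt _ _) lt_i).
Qed.

Lemma color_code_lt x : color_code (vertex_color x) < k * D + 3.
Proof.
have [] := vertex_color_bounds x; rewrite /color_code addn3.
by case: vertex_color => [[|i] c] //= cD _; nia.
Qed.

Lemma color_code_inj x y :
  color_code (vertex_color x) = color_code (vertex_color y) ->
  vertex_color x = vertex_color y.
Proof.
have [] := vertex_color_bounds x; have [] := vertex_color_bounds y.
case: (vertex_color x) (vertex_color y) => [i c] [i' c'] /=.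
case: i i' => [|i] [|i'] //= c'D c'0 _ cD c0 _; rewrite /color_code //=.
  by move=> _; rewrite c0 ?c'0.
case=> e; have D_gt0 : 0 < D by lia.
have := congr1 (divn^~ D) e; have := congr1 (modn^~ D) e.
by rewrite !modnMDl !modn_small // !divnMDl // !divn_small // !addn0 => -> ->.
Qed.

Lemma fractional_power_colorable :
  colorable (fractional_power G k.*2.+1 n) (k * D + 3).
Proof.
apply/existsP; exists [ffun x => Ordinal (color_code_lt x)].
apply/forallP => x; apply/forallP => y; apply/implyP => xy; rewrite !ffunE.
by apply: contraNneq (vertex_color_proper xy) => -[/color_code_inj->].
Qed.

End Coloring.

Theorem theorem2 (G : sgraph) (m n : nat) :
  4 <= max_degree G -> 1 < m -> m < n -> odd m ->
  chromatic_number (fractional_power G m n)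
    <= clique_number (fractional_power G m n) + 2.
Proof.
move=> D_ge4 m_gt1 mn odd_m; have mE : m = m./2.*2.+1.
  by rewrite -[LHS]odd_double_half odd_m.
move: m_gt1 mn; rewrite mE; move: m./2 => k k_gt0 n_ge {m odd_m mE}.
have {}k_gt0 : 0 < k by lia.
have deg_le (u : G) : #|[set v | adj u v]| <= max_degree G.
  exact: (leq_bigmax (F := fun u : G => #|[set v | adj u v]|)).
have [|h [h_lt h_inj h_sym]] := half_edge_coloring_ex _ deg_le; first lia.
have col := fractional_power_colorable k_gt0 n_ge D_ge4 h_lt h_inj h_sym.
rewrite /chromatic_number; case: ex_minnP => c _ /(_ _ col) c_le.
(* With kD + 3 colours available, this clique bound even gives chi <= omega + 1. *)
suff: k * max_degree G + 2 <= clique_number (fractional_power G k.*2.+1 n).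
  by lia.
have G_gt0 : 0 < #|G|.
  rewrite lt0n; apply: contraTneq D_ge4 => /eqP/pred0P G0.
  by rewrite /max_degree big_pred0.
have [u deg_u] := eq_bigmax (fun u : G => #|[set v | adj u v]|) G_gt0.
rewrite /max_degree deg_u; apply: clique_number_ge => //.
by rewrite -deg_u; apply: leq_trans D_ge4.
Qed.
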